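(* As $n\to\infty$, $$\mathbb P_n(\mathcal F\text{ is non-condensed})\;=\;\frac{R(n)}{W(n)}\;=\;2^{-2^{n-1}(1+o(1))},$$ i.e. a $\mathbb P_n$-distributed random intersecting family is condensed, that is, contained in some single star $\mathrm{Star}(i)$, $i\in[n]$, with probability $1-2^{-2^{n-1}(1+o(1))}\to1$. Moreover, the sharper constant is $$\mathbb P_n(\mathcal F\text{ is non-condensed})=(3+o(1))\,2^{-2^{n-1}}.$$
   Context: $[n]=\{1,\dots,n\}$; $V_n$ is the set of nonempty subsets of $[n]$. A family $\mathcal F\subseteq V_n$ is intersecting if $A\cap B\ne\varnothing$ for all $A,B\in\mathcal F$ (the empty family is intersecting); these are exactly the independent sets of the disjointness graph $D_n$ on $V_n$, in which $S\sim T$ whenever $S\cap T=\varnothing$. The kernel is $\ker\mathcal F=\bigcap_{S\in\mathcal F}S$, with $\ker\varnothing=[n]$; $\mathcal F$ is non-condensed (non-trivial, kernel-free) if $\ker\mathcal F=\varnothing$, and condensed (trivial) otherwise. $\mathrm{Star}(i)=\{S\in V_n:i\in S\}$. The weight is $w(S)=2^{2^{n-|S|}}-1$ for $S\in V_n$. $W(n)=\sum_{\mathcal F}\prod_{S\in\mathcal F}w(S)$ over all intersecting families $\mathcal F\subseteq V_n$ (empty product $=1$), and $R(n)$ is the same sum restricted to non-condensed families. $\mathbb P_n$ is the Gibbs distribution of the hard-core gas $(D_n,w)$: the probability distribution on intersecting families given by $\mathbb P_n(\mathcal F)=\prod_{S\in\mathcal F}w(S)/W(n)$. *)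

(* Defs.v *)
From HB Require Import structures.
From mathcomp Require Import all_boot all_order all_algebra.
From mathcomp Require Import reals.

Set Implicit Arguments.
Unset Strict Implicit.
Unset Printing Implicit Defensive.
Import Order.TTheory GRing.Theory Num.Theory.

Local Open Scope ring_scope.

(* The ground set [n] is 'I_n = {0, ..., n-1}; families are of type
   {set {set 'I_n}}. *)

Definition vertices (n : nat) : {set {set 'I_n}} := [set S | S != set0].

Definition intersecting (n : nat) (F : {set {set 'I_n}}) : bool :=
  (F \subset vertices n) &&
  [forall A in F, forall B in F, A :&: B != set0].

(* The big intersection over an empty family is [set: 'I_n]. *)
Definition kernel (n : nat) (F : {set {set 'I_n}}) : {set 'I_n} :=
  \bigcap_(S in F) S.

Definition noncondensed (n : nat) (F : {set {set 'I_n}}) : bool :=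
  kernel F == set0.

Definition condensed (n : nat) (F : {set {set 'I_n}}) : bool :=
  ~~ noncondensed F.

Definition Star (n : nat) (i : 'I_n) : {set {set 'I_n}} :=
  [set S in vertices n | i \in S].

Definition weight (K : realType) (n : nat) (S : {set 'I_n}) : K :=
  2 ^+ (2 ^ (n - #|S|))%N - 1.

Definition weight_prod (K : realType) (n : nat) (F : {set {set 'I_n}}) : K :=
  \prod_(S in F) weight K S.

Definition Wsum (K : realType) (n : nat) : K :=
  \sum_(F : {set {set 'I_n}} | intersecting F) weight_prod K F.

Definition Rsum (K : realType) (n : nat) : K :=
  \sum_(F : {set {set 'I_n}} | intersecting F && noncondensed F)
    weight_prod K F.

(* The Gibbs distribution as a mass function on all families, null outside the
   intersecting ones. *)
Definition gibbs (K : realType) (n : nat) (F : {set {set 'I_n}}) : K :=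
  if intersecting F then weight_prod K F / Wsum K n else 0.

Definition Prob (K : realType) (n : nat) (E : pred {set {set 'I_n}}) : K :=
  \sum_(F | E F) gibbs K F.

Lemma intersecting_independent (n : nat) (F : {set {set 'I_n}}) :
  intersecting F =
  (F \subset vertices n) &&
  [forall A in F, forall B in F, ~~ [disjoint A & B]].
Proof.
rewrite /intersecting; congr (_ && _).
apply: eq_forallb => A; congr (_ ==> _).
by apply: eq_forallb => B; rewrite setI_eq0.
Qed.

Lemma weight_prod_ge0 (K : realType) (n : nat) (F : {set {set 'I_n}}) :
  0 <= weight_prod K F.
Proof.
by apply: prodr_ge0 => S _; rewrite subr_ge0 exprn_ege1 // ler1n.
Qed.

Lemma Wsum_gt0 (K : realType) (n : nat) : 0 < Wsum K n.
Proof.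
have I0 : intersecting (set0 : {set {set 'I_n}}).
  by rewrite /intersecting sub0set; apply/forall_inP => A; rewrite inE.
rewrite /Wsum (bigD1 set0) //= {1}/weight_prod big_set0 ltr_pwDl //.
by apply: sumr_ge0 => F _; exact: weight_prod_ge0.
Qed.

Lemma gibbs_ge0 (K : realType) (n : nat) (F : {set {set 'I_n}}) :
  0 <= gibbs K F.
Proof.
rewrite /gibbs; case: ifP => // _.
by rewrite divr_ge0 ?weight_prod_ge0 // ltW // Wsum_gt0.
Qed.

Lemma gibbs_sum1 (K : realType) (n : nat) :
  \sum_(F : {set {set 'I_n}}) gibbs K F = 1.
Proof.
by rewrite /gibbs -big_mkcond /= -mulr_suml divff // gt_eqF // Wsum_gt0.
Qed.

(* Main.v *)
Require Import Defs.
From HB Require Import structures.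
From mathcomp Require Import all_boot all_order all_algebra.
From mathcomp Require Import reals.
From mathcomp Require Import zify ring lra.

(** Giving each S in F a nonempty set of subsets of its complement turns
    [\sum_(F \subset M) weight_prod K F] into [2 ^ mass M], where [mass M] counts
    the 3-colorings of the ground set whose class of a given color lies in M.
    For intersecting M at most one color class of a coloring lies in M, so
    [3 * mass M] is [3 ^ n] minus the number of colorings with no class in M.

    Each inclusion-minimal member B of M with 3 <= |B| <= n - 2 produces at
    least [3 * (3 * 2 ^ (n - 2) - 8)] such colorings, and so do, when M contains
    the three pairs of a triangle, the colorings separating its vertices.  Hence
    a maximal intersecting family is a star, or the Hilton-Milner family of some i (the
    star of i without {i}, plus the complement of {i}), whose mass is
    [3 ^ (n - 1) - 2 ^ (n - 1) + 2], or has mass at most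
    [3 ^ (n - 1) - 3/2 * 2 ^ (n - 1) + 8].  There are few enough maximal families
    for a union bound over the last kind: they are determined by monotone
    functions on n - 1 points, and since there are only 168 < 2 ^ (15/2) monotone
    functions on 4 points, their number is at most
    [2 ^ (15/32 * 2 ^ (n - 1))], which is beaten by the extra loss
    [1/2 * 2 ^ (n - 1)].  The Hilton-Milner families, whose complement of {i} has
    weight 3, contribute [3 * n * 2 ^ (3 ^ (n - 1) - 2 ^ (n - 1))] and the stars
    [n * 2 ^ (3 ^ (n - 1))]. *)

Set Implicit Arguments.
Unset Strict Implicit.
Unset Printing Implicit Defensive.
Import Order.TTheory GRing.Theory Num.Theory.

Local Open Scope nat_scope.

(** * Intersecting families and complements *)

Lemma intersectingP (n : nat) (F : {set {set 'I_n}}) :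
  reflect {in F &, forall A B, A :&: B != set0} (intersecting F).
Proof.
apply: (iffP andP) => [[_ /forall_inP intF] A B AF BF|intF].
  by have /forall_inP := intF A AF; apply.
split; last by apply/forall_inP => A AF; apply/forall_inP => B; exact: intF.
by apply/subsetP => A AF; have := intF A A AF AF; rewrite setIid inE.
Qed.

Lemma disjoint_notin (n : nat) (F : {set {set 'I_n}}) (A B : {set 'I_n}) :
  intersecting F -> A \in F -> A :&: B = set0 -> B \notin F.
Proof.
move=> /intersectingP intF AF AB0; apply/negP => BF.
by have := intF A B AF BF; rewrite AB0 eqxx.
Qed.

Lemma setC_notin (n : nat) (F : {set {set 'I_n}}) (A : {set 'I_n}) :
  intersecting F -> A \in F -> ~: A \notin F.
Proof. by move=> intF AF; apply: disjoint_notin intF AF (setICr A). Qed.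

(** * Mass and 3-colorings *)

Definition mass (n : nat) (M : {set {set 'I_n}}) : nat :=
  \sum_(S in M) 2 ^ (n - #|S|).

Lemma mass_setD (n : nat) (M A : {set {set 'I_n}}) :
  A \subset M -> mass M = mass A + mass (M :\: A).
Proof.
by move=> AM; rewrite /mass (big_setID A) (setIidPr AM).
Qed.

Definition color_class (n : nat) (x : {ffun 'I_n -> 'I_3}) (c : 'I_3) :
  {set 'I_n} := [set k | x k == c].

(** Points of [S] are forced to have color [c]; every other point keeps the two remaining colors. *)
Lemma card_color_class_eq (n : nat) (c : 'I_3) (S : {set 'I_n}) :
  #|[set x | color_class x c == S]| = 2 ^ (n - #|S|).
Proof.
pose P k : pred 'I_3 := if k \in S then pred1 c else predC1 c.
have -> : #|[set x | color_class x c == S]|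
        = #|(family P : simpl_pred {ffun 'I_n -> 'I_3})|.
  apply: eq_card => x; rewrite inE; apply/eqP/familyP => [xS k|xP].
    by rewrite /P -xS inE; case: ifP => [/eqP|] xk; rewrite inE xk.
  apply/setP => k; have := xP k; rewrite inE /P.
  by case: ifP => _; rewrite inE // => /negPf.

rewrite card_family foldrE big_image (eq_bigr (fun k => if k \in S then 1 else 2)).
  rewrite (bigID (mem S)) /= big1 => [|k ->//]; rewrite mul1n.
  rewrite (eq_bigr (fun=> 2)) => [|k /negPf->//].
  by rewrite prod_nat_const -[X in X - _]card_ord -(cardC (mem S)) addKn.
by move=> k _; rewrite /P; case: ifP => _; rewrite ?card1 // cardC1 card_ord.
Qed.

Lemma mass_color_class (n : nat) (M : {set {set 'I_n}}) (c : 'I_3) :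
  mass M = #|[set x | color_class x c \in M]|.
Proof.
rewrite -sum1_card (partition_big (fun x => color_class x c) (mem M)) /=.
  apply: eq_bigr => S SM; rewrite -(card_color_class_eq c) -sum1_card.
  apply: eq_bigl => x; rewrite !inE.
  by case: eqP => [->|_]; rewrite ?SM ?andbF.
by move=> x; rewrite inE.
Qed.

(** Two classes of one coloring are disjoint, so at most one of them lies in [M]. Hence the sets
    [E c] (class [c] in [M], or member of [D c]) are pairwise disjoint, and each has at least
    [mass M + d] of the [3 ^ n] colorings. *)
Lemma mass_loss (n d : nat) (M : {set {set 'I_n}})
    (D : 'I_3 -> {set {ffun 'I_n -> 'I_3}}) :
  0 < n -> intersecting M ->
  (forall c x c', x \in D c -> color_class x c' \notin M) ->
  (forall c c' x, x \in D c -> x \in D c' -> c = c') ->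
  (forall c, d <= #|D c|) ->
  mass M + d <= 3 ^ n.-1.
Proof.
move=> n0 intM DM Dinj Dd.
pose E c := [set x | color_class x c \in M] :|: D c.
have cardE c : mass M + d <= #|E c|.
  rewrite cardsU (mass_color_class M c) (_ : _ :&: _ = set0).
    by rewrite cards0 subn0 leq_add2l.
  apply/setP => x; rewrite !inE; apply/negP => /andP[xM xD].
  by have := DM c x c xD; rewrite xM.
have Einj c c' x : x \in E c -> x \in E c' -> c = c'.
  rewrite !inE => /orP[xc|xc] /orP[xc'|xc'].
  - apply/eqP/negPn/negP => cc'; apply/negP: xc'.
    apply: disjoint_notin intM xc _; apply/setP => k; rewrite !inE.
    by apply/negP => /andP[/eqP-> /eqP cE]; rewrite cE eqxx in cc'.
  - by move: (DM _ _ c xc'); rewrite xc.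
  - by move: (DM _ _ c' xc); rewrite xc'.
  - exact: Dinj xc xc'.
have : \sum_(c < 3) #|E c| <= 3 ^ n.
  have -> : 3 ^ n = #|{: {ffun 'I_n -> 'I_3}}| by rewrite card_ffun !card_ord.
  rewrite -sum1_card (eq_bigr (fun c => \sum_x (x \in E c))); last first.
    by move=> c _; rewrite -sum1_card big_mkcond.
  rewrite exchange_big leq_sum //= => x _.
  rewrite -big_mkcond sum1_card; apply/card_le1_eqP => c c' xc xc'.
  exact: Einj xc' xc.
move=> sumE; rewrite -(leq_pmul2l (isT : 0 < 3)) -expnS (prednK n0).
apply: leq_trans sumE; rewrite -{1}(card_ord 3) -sum_nat_const.
by apply: leq_sum => c _; exact: cardE.
Qed.

(** * Loss caused by a minimal member *)

Lemma three_colors (c : 'I_3) : exists a b : 'I_3,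
  [/\ a != c, b != c, a != b & forall d, [|| d == c, d == a | d == b]].
Proof.
case: c => [[|[|[|//]]]] lt3.
- by exists (@Ordinal 3 1 isT), (@Ordinal 3 2 isT); split=> // -[[|[|[|]]]].
- by exists (@Ordinal 3 0 isT), (@Ordinal 3 2 isT); split=> // -[[|[|[|]]]].
- by exists (@Ordinal 3 0 isT), (@Ordinal 3 1 isT); split=> // -[[|[|[|]]]].
Qed.

Lemma card_supersets (T : finType) (B : {set T}) :
  #|[set X : {set T} | B \subset X]| = 2 ^ #|~: B|.
Proof.
rewrite -card_powerset -(card_imset (powerset _) (inv_inj (@setCK T))).
apply: eq_card => X; rewrite inE; apply/idP/imsetP => [BX|[Y]].
  by exists (~: X); rewrite ?setCK // inE setCS.
by rewrite inE -(setCK Y) setCS setCK => BY ->.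
Qed.

(** Asking that [c] be the only color absent from [B] makes these sets disjoint for distinct [c], so
    that they can serve as the [D c] of [mass_loss]. *)
Definition missing (n : nat) (M : {set {set 'I_n}}) (B : {set 'I_n})
    (c : 'I_3) : {set {ffun 'I_n -> 'I_3}} :=
  [set x | (color_class x c :&: B == set0) &&
           [forall d, (d != c) ==> (color_class x d :&: B != set0)] &&
           [forall d, color_class x d \notin M]].

Lemma missingP (n : nat) (M : {set {set 'I_n}}) (B : {set 'I_n})
    (c : 'I_3) (x : {ffun 'I_n -> 'I_3}) :
  reflect [/\ color_class x c :&: B = set0,
              forall d, d != c -> color_class x d :&: B != set0 &
              forall d, color_class x d \notin M]
          (x \in missing M B c).
Proof.
rewrite inE; apply: (iffP andP) => [[/andP[/eqP ? /forall_inP ?] /forallP ?] //|].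
by case=> -> ? ?; rewrite eqxx; split; [apply/forall_inP|apply/forallP].
Qed.

Lemma card_missing (n : nat) (M : {set {set 'I_n}}) (B : {set 'I_n})
    (c : 'I_3) :
  intersecting M -> B \in M -> (forall P : {set 'I_n}, P \proper B -> P \notin M) ->
  2 ^ n <= #|missing M B c| + 2 ^ (n - #|B|).+1 + 2 ^ #|B|.
Proof.
move=> intM BM minB.
have [a [b [ac bc ab col]]] := three_colors c.
(* Excluded are the sets that avoid [B], contain [B], or contain the complement of [B]. The last
   exclusion serves the injectivity of [phi] below: it separates the images of its two branches. *)
pose bad := (powerset (~: B) :|: [set X : {set 'I_n} | B \subset X])
              :|: [set X : {set 'I_n} | ~: B \subset X].
have cardCB : #|~: B| = n - #|B|.
  by rewrite cardsCs setCK card_ord.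
have card_bad : #|bad| <= 2 ^ (n - #|B|).+1 + 2 ^ #|B|.
  rewrite (leq_trans (leq_card_setU _ _)) // leq_add //.
    rewrite (leq_trans (leq_card_setU _ _)) // card_powerset card_supersets.
    by rewrite cardCB expnS mul2n addnn.
  by rewrite card_supersets setCK.
pose tri (S1 S2 : {set 'I_n}) : {ffun 'I_n -> 'I_3} :=
  [ffun k => if k \in S1 then a else if k \in S2 then b else c].
have tria S1 S2 : color_class (tri S1 S2) a = S1.
  apply/setP => k; rewrite inE ffunE; case: ifP => [|_]; first by rewrite eqxx.
  by case: ifP => _; apply/negbTE; rewrite eq_sym // ab.
have trib S1 S2 : color_class (tri S1 S2) b = S2 :\: S1.
  apply/setP => k; rewrite !inE ffunE; case: ifP => [|_] /=.
    by move=> _; apply/negbTE.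
  by case: ifP => _; rewrite ?eqxx //; apply/negbTE; rewrite eq_sym.
have tric S1 S2 : color_class (tri S1 S2) c = ~: (S1 :|: S2).
  apply/setP => k; rewrite !inE ffunE; case: ifP => [|_] /=.
    by move=> _; apply/negbTE.
  by case: ifP => _; rewrite ?eqxx //; apply/negbTE.
(* When X meets B in a nonempty proper subset, all three classes of phi X avoid
   M: each is a proper subset of B, or misses B, or is X itself in the case
   X \notin M, or is the complement of X in the case X \in M. *)
pose phi (X : {set 'I_n}) :=
  if X \in M then tri (X :&: B) (~: X) else tri X (B :\: X).
have phi_inj : {in ~: bad &, injective phi}.
  move=> X Y; rewrite !inE !negb_or => /andP[/andP[_ _] CX] /andP[/andP[_ _] CY].
  rewrite /phi; case: ifP => XM; case: ifP => YM eqXY.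
  - have := congr1 (fun x => ~: color_class x b) eqXY.
    rewrite !trib !setCD !setCK => E.
    by rewrite -[LHS](setUidPl (subsetIl X B)) E (setUidPl (subsetIl Y B)).
  - have E1 := congr1 (fun x => color_class x a) eqXY.
    have E2 := congr1 (fun x => color_class x b) eqXY.
    case/negP: CX; apply/subsetP => k; rewrite inE => kB.
    move/setP/(_ k): E2; rewrite !trib !inE (negPf kB) /= !andbF.
    by case: (k \in X).
  - have E2 := congr1 (fun x => color_class x b) eqXY.
    case/negP: CY; apply/subsetP => k; rewrite inE => kB.
    move/setP/(_ k): E2; rewrite !trib !inE (negPf kB) /= !andbF.
    by case: (k \in Y).
  - by have := congr1 (fun x => color_class x a) eqXY; rewrite !tria.
rewrite -addnA addnC -leq_subLR.
have cardC : 2 ^ n - #|bad| = #|~: bad|.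
  rewrite [RHS]cardsCs setCK -[#|{set _}|]cardsT -powersetT card_powerset.
  by rewrite cardsT card_ord.
apply: leq_trans (leq_sub2l _ card_bad) _.
rewrite cardC -(card_in_imset phi_inj); apply/subset_leq_card/subsetP.
move=> _ /imsetP[X Xbad ->]; rewrite !inE !negb_or in Xbad.
have /andP[/andP[XB BX] _] := Xbad.
have inter_B S : S :&: B = set0 -> S \notin M.
  by move=> SB; apply: disjoint_notin intM BM _; rewrite setIC.
have prop_XB : X :&: B \proper B.
  by rewrite properEneq subsetIr andbT; apply: contra BX => /eqP/setIidPr.
have XB0 : X :&: B != set0.
  by apply: contra XB => /eqP XB0; rewrite -disjoints_subset -setI_eq0 XB0.
have BX0 : B :\: X != set0 by rewrite setD_eq0.
have prop_BX : B :\: X \proper B.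
  rewrite properEneq subsetDl andbT; apply: contra XB0.
  by move=> /eqP/setDidPl; rewrite -setI_eq0 setIC.
have triM S1 S2 : B \subset S1 :|: S2 -> S1 :&: B != set0 ->
    (S2 :\: S1) :&: B != set0 -> S1 \notin M -> S2 :\: S1 \notin M ->
    tri S1 S2 \in missing M B c.
  move=> BS S1B S2B S1M S2M.
  have cB : ~: (S1 :|: S2) :&: B = set0.
    by apply/eqP; rewrite setIC -setDE setD_eq0.
  apply/missingP; split=> [|d dc|d]; first by rewrite tric.
    by have := col d; rewrite (negPf dc) /= => /orP[]/eqP->; rewrite ?tria ?trib.
  case/or3P: (col d) => /eqP->; rewrite ?tria ?trib ?tric //.
  exact: inter_B.
rewrite /phi; case: ifP => XM.
  have CXB : ~: X :\: (X :&: B) = ~: X.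
    by apply/setP => k; rewrite !inE; case: (k \in X); rewrite ?andbF.
  apply: triM; rewrite ?CXB ?setC_notin //.
  - by apply/subsetP => k kB; rewrite !inE kB; case: (k \in X).
  - by rewrite -setIA setIid.
  - by rewrite setIC -setDE.
  - exact: minB.
have BXX : B :\: X :\: X = B :\: X by rewrite setDDl setUid.
apply: triM; rewrite ?BXX ?XM //.
- by apply/subsetP => k kB; rewrite !inE kB; case: (k \in X).
- by rewrite (setIidPl _) // subsetDl.
- exact: minB.
Qed.

Lemma mass_minimal (n : nat) (M : {set {set 'I_n}}) (B : {set 'I_n}) :
  intersecting M -> B \in M ->
  (forall P : {set 'I_n}, P \proper B -> P \notin M) ->
  2 < #|B| -> #|B| <= n - 2 ->
  mass M + 3 * 2 ^ (n - 2) <= 3 ^ n.-1 + 8.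
Proof.
move=> intM BM minB B3 Bn.
have n4 : 4 < n by lia.
have loss : mass M + (2 ^ n - (2 ^ (n - #|B|).+1 + 2 ^ #|B|)) <= 3 ^ n.-1.
  apply: (@mass_loss _ _ _ (missing M B)) => //; first by lia.
  - by move=> c x c' /missingP[].
  - move=> c c' x /missingP[xc _ _] /missingP[_ xc' _].
    by apply/eqP/negPn/negP => /xc'; rewrite xc eqxx.
  - by move=> c; rewrite leq_subLR addnC addnA; exact: card_missing.
have B8 : 8 <= 2 ^ #|B| by rewrite (leq_pexp2l (isT : 0 < 2) B3).
have C8 : 8 <= 2 ^ (n - #|B|).+1.
  by rewrite (@leq_pexp2l 2 3) //; lia.
have BC : 2 ^ #|B| * 2 ^ (n - #|B|).+1 = 8 * 2 ^ (n - 2).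
  by rewrite -expnD -[8]/(2 ^ 3) -expnD; congr (2 ^ _); lia.
have En : 2 ^ n = 4 * 2 ^ (n - 2).
  by rewrite -[4]/(2 ^ 2) -expnD; congr (2 ^ _); lia.
(* With [u = 2 ^ (n - #|B|).+1] and [w = 2 ^ #|B|], both at least 8, expanding
   [(u - 8) * (w - 8) >= 0] and using [u * w = 8 * 2 ^ (n - 2)] gives [u + w <= 2 ^ (n - 2) + 8]. *)
move: loss B8 C8 BC En.
move: (2 ^ _.+1) (2 ^ #|B|) (2 ^ n) (2 ^ (n - 2)) (3 ^ _) (mass M).
move=> u w p q t v; nia.
Qed.

(** * Loss caused by a triangle *)

Lemma leq_pow2_pow3 (k : nat) : 1 < k -> 6 * 2 ^ k <= 2 * 3 ^ k + 8.
Proof.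
case: k => [|[|[|k]]] // _; suff : 3 * 2 ^ k.+3 <= 3 ^ k.+3 by lia.
by elim: k => // k IHk; rewrite [2 ^ _]expnS [3 ^ k.+4]expnS; lia.
Qed.

Lemma card_coloring3 (n : nat) (i j l : 'I_n) (a b c : 'I_3) :
  i != j -> i != l -> j != l ->
  #|[set x : {ffun 'I_n -> 'I_3} | [&& x i == a, x j == b & x l == c]]|
    = 3 ^ (n - 3).
Proof.
move=> ij il jl; pose P k : pred 'I_3 :=
  if k == i then pred1 a else if k == j then pred1 b else
  if k == l then pred1 c else predT.
have -> : #|[set x : {ffun 'I_n -> 'I_3} |
              [&& x i == a, x j == b & x l == c]]|
        = #|(family P : simpl_pred {ffun 'I_n -> 'I_3})|.
  apply: eq_card => x; rewrite inE; apply/and3P/familyP => [[xi xj xl] k|xP].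
    rewrite /P; case: eqP => [->|_] //; case: eqP => [->|_] //.
    by case: eqP => [->|_].
  have := xP i; have := xP j; have := xP l; rewrite /P !eqxx.
  by rewrite (eq_sym j) (eq_sym l) (eq_sym l) (negPf ij) (negPf il) (negPf jl).
rewrite card_family foldrE big_image.
pose T := [set i; j; l].
have T3 : #|T| = 3 
    by rewrite /T setUC cardsU1 cards2 !inE !(eq_sym l) (negPf il) (negPf jl) ij.
rewrite (eq_bigr (fun k => if k \in T then 1 else 3)) => [|k _]; last first.
  rewrite /P !inE; case: eqP => _; first by rewrite card1.
  case: eqP => _; first by rewrite card1.
  by case: eqP => _; rewrite ?card1 // cardT size_enum_ord.
rewrite (bigID (mem T)) /= big1 => [|k ->//]; rewrite mul1n.
rewrite (eq_bigr (fun=> 3)) => [|k /negPf->//].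
by rewrite prod_nat_const -[X in X - _]card_ord -(cardC (mem T)) -T3 addKn.
Qed.

(** When [i], [j] and [l] get three different colors, each class contains exactly one of them and
    misses the pair formed by the other two, so no class lies in [M]. For each color of [i] there
    are [2 * 3 ^ (n - 3)] such colorings. *)
Lemma mass_triangle (n : nat) (M : {set {set 'I_n}}) (i j l : 'I_n) :
  4 < n -> intersecting M -> i != j -> i != l -> j != l ->
  [set i; j] \in M -> [set i; l] \in M -> [set j; l] \in M ->
  mass M + 3 * 2 ^ (n - 2) <= 3 ^ n.-1 + 8.
Proof.
move=> n4 intM ij il jl ijM ilM jlM.
pose D c := [set x : {ffun 'I_n -> 'I_3} |
  [&& x i == c, x j != c, x l != c & x j != x l]].
have notin_pair (u v : 'I_n) (x : {ffun 'I_n -> 'I_3}) d :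
    [set u; v] \in M -> x u != d -> x v != d -> color_class x d \notin M.
  move=> uvM xu xv; apply: disjoint_notin intM uvM _; apply/setP => k.
  by rewrite !inE; apply/negP => /andP[/orP[]/eqP->]; apply/negP.
have loss : mass M + 2 * 3 ^ (n - 3) <= 3 ^ n.-1.
  apply: (@mass_loss _ _ _ D) => //; first by lia.
  - move=> c x c'; rewrite inE => /and4P[/eqP xi xj xl xjl].
    have [xi'|xi'] := boolP (x i == c').
      by move: xi'; rewrite xi => /eqP<-; apply: notin_pair jlM _ _.
    have [xj'|xj'] := boolP (x j == c').
      by apply: notin_pair ilM _ _; rewrite // -(eqP xj') eq_sym.
    exact: notin_pair ijM _ _.
  - by move=> c c' x; rewrite !inE => /and4P[/eqP<- _ _ _] /and4P[/eqP<-].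
  - move=> c; have [a [b [ac bc ab _]]] := three_colors c.
    pose U a b := [set x : {ffun 'I_n -> 'I_3} |
                    [&& x i == c, x j == a & x l == b]].
    have UD : U a b :|: U b a \subset D c.
      apply/subsetP => x; rewrite !inE => /orP[]/and3P[-> /eqP-> /eqP->] /=.
        by rewrite ac bc.
      by rewrite ac bc eq_sym.
    apply: leq_trans (subset_leq_card UD); rewrite cardsU.
    have -> : U a b :&: U b a = set0.
      apply/setP => x; rewrite !inE; apply/negP.
      by case/andP=> /and3P[_ /eqP-> _] /and3P[_]; rewrite (negPf ab).
    by rewrite cards0 subn0 !card_coloring3 // addnn mul2n.
(* The loss [2 * 3 ^ (n - 3)] is at least [6 * 2 ^ (n - 3) - 8], the same bound as for a minimal
   member. *)
have := @leq_pow2_pow3 (n - 3) ltac:(lia).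
have -> : 3 * 2 ^ (n - 2) = 6 * 2 ^ (n - 3).
  by rewrite (_ : n - 2 = (n - 3).+1); [rewrite expnS; lia | lia].
move: loss; lia.
Qed.

(** * Structure of maximal intersecting families *)

Lemma maximal_meets (n : nat) (M : {set {set 'I_n}}) (S : {set 'I_n}) :
  maxset (@intersecting n) M ->
  S != set0 -> {in M, forall A, A :&: S != set0} -> S \in M.
Proof.
move=> maxM S0 MS; have intM := maxsetp maxM.
suff /(maxsetsup maxM)/(_ (subsetUr _ _)) <- : intersecting (S |: M).
  by rewrite setU11.
apply/intersectingP => A B /setU1P[->|AM] /setU1P[->|BM].
- by rewrite setIid.
- by rewrite setIC MS.
- exact: MS.
- exact: (intersectingP _ intM).
Qed.

Lemma maximal_up (n : nat) (M : {set {set 'I_n}}) (A B : {set 'I_n}) :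
  maxset (@intersecting n) M -> A \in M -> A \subset B -> B \in M.
Proof.
move=> maxM AM AB; have intM := intersectingP _ (maxsetp maxM).
have A0 : A != set0 by have := intM _ _ AM AM; rewrite setIid.
apply: (maximal_meets maxM) => [|C CM].
  by apply: contra A0 => /eqP B0; rewrite -subset0 -B0.
by apply: contra (intM _ _ CM AM); rewrite -!subset0; apply/subset_trans/setIS.
Qed.

(** A nonempty set outside [M] is disjoint from some member of [M], and its complement contains that
    member. *)
Lemma maximal_setC (n : nat) (M : {set {set 'I_n}}) (A : {set 'I_n}) :
  maxset (@intersecting n) M -> 0 < n -> A \notin M -> ~: A \in M.
Proof.
move=> maxM n0 AM; have [A0|A0] := eqVneq A set0.
  rewrite A0 setC0; apply: (maximal_meets maxM) => [|C CM].
    by apply/set0Pn; exists (Ordinal n0).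
  rewrite setIT.
  by have := intersectingP _ (maxsetp maxM) _ _ CM CM; rewrite setIid.
have [/forall_inP /(maximal_meets maxM A0)|] :=
  boolP [forall C in M, C :&: A != set0]; first by rewrite (negPf AM).
rewrite negb_forall_in => /exists_inP[C CM /negPn/eqP CA].
by apply: maximal_up maxM CM _; rewrite -disjoints_subset -setI_eq0 CA.
Qed.

Definition hilton_milner (n : nat) (i : 'I_n) : {set {set 'I_n}} :=
  [set~ i] |: (Star i :\ [set i]).

(** Once singletons and minimal members of size 3 to [n - 2] are excluded, every member of size at
    most [n - 2] contains a pair of [M]. Starting from one pair [[set i; j]] of [M], either all
    pairs through [i] or all pairs through [j] are in [M], which gives a Hilton-Milner family, or
    [M] contains a triangle. *)
Lemma maximal_cases (n : nat) (M : {set {set 'I_n}}) :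
  4 < n -> maxset (@intersecting n) M ->
  [\/ exists i, M \subset Star i, exists i, M \subset hilton_milner i |
      mass M + 3 * 2 ^ (n - 2) <= 3 ^ n.-1 + 8].
Proof.
move=> n4 maxM; have intM := maxsetp maxM.
have n0 : 0 < n by lia.
have meetM := intersectingP _ intM.
have [/existsP[i iM]|no1] := boolP [exists i, [set i] \in M].
  apply: Or31; exists i; apply/subsetP => S SM; have := meetM _ _ iM SM.
  rewrite !inE; case/set0Pn=> k; rewrite !inE => /andP[/eqP-> iS].
  by rewrite iS andbT; apply/set0Pn; exists i.
have [|noB] := boolP [exists B in M, [forall P in M, ~~ (P \proper B)] &&
                                     (2 < #|B| <= n - 2)].
  case/exists_inP=> B BM /andP[/forall_inP minB /andP[B3 Bn]].
  apply: Or33; apply: mass_minimal BM _ B3 Bn => // P PB.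
  by apply/negP => /minB; rewrite PB.
have small S : S \in M -> #|S| <= n - 2 ->
    exists i j : 'I_n, [/\ i != j, [set i; j] \in M & [set i; j] \subset S].
  move=> SM Sn; have [B /minsetP[BM minB] BS] := @minset_exists _ (mem M) S SM.
  have B2 : #|B| = 2.
    apply/eqP; rewrite eqn_leq; apply/andP; split.
      rewrite leqNgt; apply: contra noB => B3; apply/exists_inP; exists B => //.
      rewrite B3 (leq_trans (subset_leq_card BS) Sn) !andbT.
      apply/forall_inP => P PM; apply/negP => /andP[PB]; apply/negP/negPn.
      by rewrite (minB P PM PB).
    rewrite ltn_neqAle lt0n cards_eq0; apply/andP; split.
      rewrite eq_sym; apply: contra no1 => /cards1P[i Bi].
      by apply/existsP; exists i; rewrite -Bi.
    by have := meetM _ _ BM BM; rewrite setIid.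
  by have /eqP/cards2P[i [j [ij EB]]] := B2; exists i, j; rewrite -EB.
have pair2 (i j : 'I_n) : i != j -> #|[set i; j]| = 2.
  by move=> ij; rewrite cards2 ij.
(* The complement of [[set i; k]] is in [M] and has size [n - 2], so it contains a pair of [M]; this
   pair avoids [i] but meets [[set i; j]], hence contains [j]. *)
have other (i j k : 'I_n) : i != j -> k != i -> k != j -> [set i; j] \in M ->
    [set i; k] \notin M -> exists l, [/\ l != i, l != k, l != j & [set j; l] \in M].
  move=> ij ki kj ijM ikM; have := maximal_setC maxM n0 ikM.
  case/small=> [|u [v [uv uvM /subsetP uvS]]].
    by rewrite cardsCs setCK card_ord pair2 // eq_sym.
  have uS : u \notin [set i; k] by have := uvS u; rewrite !inE eqxx; apply.
  have vS : v \notin [set i; k].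
    by have := uvS v; rewrite !inE eqxx orbT; apply.
  have /set0Pn[m] := meetM _ _ ijM uvM; move: uS vS; rewrite !inE !negb_or.
  move=> /andP[ui uk] /andP[vi vk] /andP[/orP[]/eqP-> /orP[]/eqP Em].
  - by rewrite Em eqxx in ui.
  - by rewrite Em eqxx in vi.
  - by exists v; rewrite Em vi vk eq_sym uv.
  - by exists u; rewrite Em ui uk uv setUC.
(* A member avoiding [i] meets each [[set i; k]] in [k], so it is the whole complement of [i]. *)
have full i : (forall k, k != i -> [set i; k] \in M) -> M \subset hilton_milner i.
  move=> iM; apply/subsetP => S SM; rewrite !inE.
  have [iS|iS] := boolP (i \in S).
    rewrite andbT; apply/orP; right; apply/andP; split.
      by apply: contra no1 => /eqP Si; apply/existsP; exists i; rewrite -Si.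
    by apply/set0Pn; exists i.
  rewrite !andbF orbF; apply/eqP/setP => k; rewrite !inE.
  have [->|ki] := eqVneq k i; first exact/negbTE.
  have /set0Pn[m] := meetM _ _ (iM k ki) SM; rewrite !inE.
  by case/andP=> /orP[]/eqP->; rewrite ?(negPf iS).
have [i [j [ij ijM]]] : exists i j : 'I_n, i != j /\ [set i; j] \in M.
  pose a := Ordinal n0; have n1 : 1 < n by lia. pose b := Ordinal n1.
  have ab : a != b by [].
  have [abM|/(maximal_setC maxM n0)] := boolP ([set a; b] \in M).
    by exists a, b.
  case/small=> [|u [v [uv uvM _]]]; last by exists u, v.
  by rewrite cardsCs setCK card_ord pair2.
have [/forall_inP iM|] := boolP [forall (k | k != i), [set i; k] \in M].
  by apply: Or32; exists i; apply: full => k /iM.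
have [/forall_inP jM _|] := boolP [forall (k | k != j), [set j; k] \in M].
  by apply: Or32; exists j; apply: full => k /jM.
(* Both [i] and [j] have a pair missing from [M]; [other] yields [[set j; l]] and [[set i; l']] in
   [M], and these can only meet if [l = l']. *)
rewrite !negb_forall_in => /exists_inP[k kj jkM] /exists_inP[k' k'i ik'M].
have k'j : k' != j by apply: contra ik'M => /eqP->.
have ki : k != i by apply: contra jkM => /eqP->; rewrite setUC.
have [l [li lk' lj jlM]] := other i j k' ij k'i k'j ijM ik'M.
have [||l' [l'j l'k l'i il'M]] := other j i k _ kj ki _ jkM.
  by rewrite eq_sym.
  by rewrite setUC.
have /set0Pn[m] := meetM _ _ jlM il'M; rewrite !inE.
case/andP=> /orP[]/eqP-> /orP[]/eqP E; last 1 first.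
- apply/Or33/(@mass_triangle _ _ i j l) => //; first by rewrite eq_sym.
    by rewrite eq_sym.
  by rewrite E.
- by rewrite E eqxx in ij.
- by rewrite -E eqxx in l'j.
- by rewrite E eqxx in li.
Qed.

(** * Counting maximal families through monotone functions *)

Fixpoint truth_table (k : nat) (f : bitseq -> bool) : bitseq :=
  if k is k'.+1 then
    truth_table k' (fun s => f (false :: s)) ++
    truth_table k' (fun s => f (true :: s))
  else [:: f [::]].

(** Split on the first variable: both halves of a monotone function are monotone and the first is
    pointwise below the second. The recursion is executable and gives the Dedekind number 168 at
    [k = 4]. *)
Fixpoint monotone_tables (k : nat) : seq bitseq :=
  if k is k'.+1 then
    [seq p.1 ++ p.2 |
      p <- [seq p <- [seq (u, v) | u <- monotone_tables k',
                                   v <- monotone_tables k']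
           | all2 implb p.1 p.2]]
  else [:: [:: false]; [:: true]].

Lemma size_monotone_tables4 : size (monotone_tables 4) = 168.
Proof. by vm_compute. Qed.

Lemma size_truth_table (k : nat) (f : bitseq -> bool) :
  size (truth_table k f) = 2 ^ k.
Proof.
by elim: k f => //= k IHk f; rewrite size_cat !IHk expnS mul2n addnn.
Qed.

Lemma truth_table_inj (k : nat) (f g : bitseq -> bool) (s : bitseq) :
  truth_table k f = truth_table k g -> size s = k -> f s = g s.
Proof.
elim: k f g s => [|k IHk] f g s /=; first by case=> + /size0nil->.
move/eqP; rewrite eqseq_cat ?size_truth_table // => /andP[/eqP E0 /eqP E1].
by case: s => //= -[] s [sk]; [apply: IHk E1 sk | apply: IHk E0 sk].
Qed.

Lemma all2_cat (S T : Type) (r : S -> T -> bool) (s1 s2 : seq S)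
    (t1 t2 : seq T) :
  size s1 = size t1 ->
  all2 r (s1 ++ s2) (t1 ++ t2) = all2 r s1 t1 && all2 r s2 t2.
Proof.
by elim: s1 t1 => [|x s1 IHs] [|y t1] //= [/IHs->]; rewrite andbA.
Qed.

Lemma truth_table_le (k : nat) (f g : bitseq -> bool) :
  (forall s, f s ==> g s) -> all2 implb (truth_table k f) (truth_table k g).
Proof.
elim: k f g => [|k IHk] f g fg /=; first by rewrite fg.
by rewrite all2_cat ?size_truth_table // !IHk.
Qed.

Lemma truth_table_monotone (k : nat) (f : bitseq -> bool) :
  (forall s t, all2 implb s t -> f s ==> f t) ->
  truth_table k f \in monotone_tables k.
Proof.
elim: k f => [|k IHk] f fmon /=; first by case: (f [::]).
apply/mapP; exists (truth_table k (fun s => f (false :: s)),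
                    truth_table k (fun s => f (true :: s))) => //.
rewrite mem_filter truth_table_le /=; last first.
  by move=> s; apply: fmon; elim: s => //= -[].
apply: allpairs_f; apply: IHk => s t st; exact: fmon.
Qed.

(** The prepended [false] keeps coordinate 0 out of the set; [s] fills coordinates 1 to 4 and [T]
    the remaining ones. *)
Definition cube_point (m : nat) (s : bitseq) (T : {set 'I_m}) :
    {set 'I_(5 + m)} :=
  [set i | match split i with
           | inl j => nth false (false :: s) j
           | inr k => k \in T
           end].

Lemma cube_point_sub (m : nat) (s t : bitseq) (T : {set 'I_m}) :
  all2 implb s t -> cube_point s T \subset cube_point t T.
Proof.
move=> st; apply/subsetP => i; rewrite !inE; case: (split i) => //.
case=> -[//|j] _ /=; elim: s t st j => [|a s IHs] [|b t] //= /andP[ab st] [|j] /=.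
  by case: a ab.
exact: IHs.
Qed.

Lemma cube_point_surj (m : nat) (A : {set 'I_(5 + m)}) :
  lshift m ord0 \notin A ->
  exists (s : bitseq) (T : {set 'I_m}), size s = 4 /\ A = cube_point s T.
Proof.
move=> A0; pose a k := lshift m (inord k : 'I_5) \in A.
exists [:: a 1; a 2; a 3; a 4], [set k | rshift 5 k \in A]; split=> //.
apply/setP => i; rewrite inE; case: splitP => j ij; last first.
  by rewrite inE; congr (_ \in A); apply: val_inj.
have -> : i = lshift m j by apply: val_inj.
have -> : j = inord j by rewrite inord_val.
case: {i ij} j => [[|[|[|[|[|//]]]]] lt5] /=; rewrite inordK //=.
apply/negbTE; congr (_ \notin A) : A0.
by apply: val_inj; rewrite /= inordK.
Qed.

(** Recording for every [j] the position of [f x j] in [tab] maps [P] injectively into the functions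
    from [J] to ['I_k.+1]. *)
Lemma card_encoding (I J : finType) (T : eqType) (k : nat) (tab : seq T)
    (P : {set I}) (f : I -> J -> T) :
  size tab = k.+1 ->
  (forall x j, x \in P -> f x j \in tab) ->
  {in P &, forall x y, (forall j, f x j = f y j) -> x = y} ->
  #|P| <= k.+1 ^ #|J|.
Proof.
move=> tabk ftab finj.
pose phi x : {ffun J -> 'I_k.+1} := [ffun j => inord (index (f x j) tab)].
have phi_inj : {in P &, injective phi}.
  move=> x y xP yP E; apply: finj => // j.
  have := congr1 (fun g : {ffun J -> 'I_k.+1} => nat_of_ord (g j)) E.
  rewrite !ffunE !inordK -?tabk ?index_mem ?ftab // => Ej.
  by rewrite -(nth_index (f x j) (ftab x j xP)) Ej nth_index ?ftab.
rewrite -(card_in_imset phi_inj) (leq_trans (max_card _)) //.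
by rewrite card_ffun card_ord.
Qed.

(* Coordinate 0 is dropped because a maximal family contains exactly one of A
   and its complement; the next four coordinates carry the monotone tables. *)
Lemma card_maximal (n : nat) : 4 < n ->
  #|[set M | maxset (@intersecting n) M]| <= 168 ^ (2 ^ (n - 5)).
Proof.
move=> n4; have -> : n = 5 + (n - 5) by lia.
move: (n - 5) => m {n n4}; rewrite addKn.
pose tr (M : {set {set 'I_(5 + m)}}) T :=
  truth_table 4 (fun s => cube_point s T \in M).
have -> : 2 ^ m = #|{set 'I_m}|.
  by rewrite -[#|{set _}|]cardsT -powersetT card_powerset cardsT card_ord.
apply: (@card_encoding _ _ _ _ _ _ tr size_monotone_tables4) => [M T|M M'].
  rewrite inE => maxM; apply: truth_table_monotone => s t st; apply/implyP.
  by move=> sM; exact: maximal_up maxM sM (cube_point_sub T st).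
rewrite !inE => maxM maxM' Etr.
have E0 (A : {set 'I_(5 + m)}) : lshift m ord0 \notin A -> (A \in M) = (A \in M').
  move=> /cube_point_surj[s [T [s4 ->]]].
  exact: (@truth_table_inj 4 (fun s => cube_point s T \in M)
           (fun s => cube_point s T \in M') s (Etr T) s4).
have memC L (A : {set 'I_(5 + m)}) : maxset (@intersecting (5 + m)) L ->
    (A \in L) = (~: A \notin L).
  move=> maxL; apply/idP/idP => [|CA].
    exact: setC_notin (maxsetp maxL).
  by rewrite -(setCK A); apply: maximal_setC CA.
apply/setP => A; have [A0|/E0//] := boolP (lshift m (@ord0 4) \in A).
by rewrite !(memC _ A) // E0 // inE A0.
Qed.

(** * Masses of stars and Hilton-Milner families *)

Lemma mass1 (n : nat) (S : {set 'I_n}) : mass [set S] = 2 ^ (n - #|S|).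
Proof. by rewrite /mass big_set1. Qed.

(** Class [c] lies in [Star i] exactly when [i] has color [c], and these three events partition the
    colorings. *)
Lemma mass_Star (n : nat) (i : 'I_n) : mass (Star i) = 3 ^ n.-1.
Proof.
have n0 : 0 < n by apply: leq_ltn_trans (ltn_ord i).
have fiber c : mass (Star i) = #|[set x : {ffun 'I_n -> 'I_3} | x i == c]|.
  rewrite (mass_color_class _ c); apply: eq_card => x; rewrite !inE.
  by apply/andP/idP => [[_]//|xi]; split=> //; apply/set0Pn; exists i; rewrite inE.
apply/eqP; rewrite -(eqn_pmul2l (isT : 0 < 3)) -expnS (prednK n0).
rewrite -{1}(card_ord 3) -sum_nat_const (eq_bigr _ (fun c _ => fiber c)).
have -> : 3 ^ n = #|{: {ffun 'I_n -> 'I_3}}| by rewrite card_ffun !card_ord.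
rewrite -sum1_card (partition_big (fun x : {ffun 'I_n -> 'I_3} => x i) predT) //=.
by apply/eqP/eq_bigr => c _; rewrite -sum1_card; apply: eq_bigl => x; rewrite inE.
Qed.

(** Compared with the star, [[set i]] of mass [2 ^ n.-1] is exchanged for [[set~ i]] of mass 2. *)
Lemma mass_hilton_milner (n : nat) (i : 'I_n) :
  mass (hilton_milner i) + 2 ^ n.-1 = 3 ^ n.-1 + 2.
Proof.
have n0 : 0 < n by apply: leq_ltn_trans (ltn_ord i).
have Si : [set [set i]] \subset Star i.
  by rewrite sub1set !inE eqxx andbT; apply/set0Pn; exists i; rewrite inE.
have Hi : [set [set~ i]] \subset hilton_milner i by rewrite sub1set setU11.
have HD : hilton_milner i :\: [set [set~ i]] = Star i :\ [set i].
  apply/setP => S; rewrite !inE; have [->|//] := eqVneq S [set~ i].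
  by rewrite !inE eqxx ?andbF.
rewrite (mass_setD Hi) HD -(mass_Star i) (mass_setD Si) !mass1 cards1 cardsC1.
by rewrite card_ord subn1 (_ : n - n.-1 = 1) ?expn1; lia.
Qed.

Lemma Star_intersecting (n : nat) (i : 'I_n) (F : {set {set 'I_n}}) :
  F \subset Star i -> intersecting F.
Proof.
move=> /subsetP Fi; apply/intersectingP => A B /Fi + /Fi; rewrite !inE.
by move=> /andP[_ iA] /andP[_ iB]; apply/set0Pn; exists i; rewrite inE iA.
Qed.

Lemma hilton_milner_intersecting (n : nat) (i : 'I_n) (F : {set {set 'I_n}}) :
  1 < n -> F \subset hilton_milner i -> intersecting F.
Proof.
move=> n1 /subsetP FH; apply/intersectingP => A B /FH + /FH.
have meet S : S != [set i] -> i \in S -> S :&: [set~ i] != set0.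
  move=> Si iS; rewrite -setDE setD_eq0; apply: contra Si => Si.
  by rewrite eqEsubset Si sub1set.
rewrite !inE => /orP[/eqP->|/and3P[Ai _ iA]] /orP[/eqP->|/and3P[Bi _ iB]].
- by rewrite setIid -card_gt0 cardsC1 card_ord; lia.
- by rewrite setIC meet.
- exact: meet.
- by apply/set0Pn; exists i; rewrite inE iA.
Qed.

Lemma condensedP (n : nat) (F : {set {set 'I_n}}) :
  intersecting F -> reflect (exists i, F \subset Star i) (condensed F).
Proof.
move=> /andP[/subsetP FV _]; apply: (iffP (set0Pn _)) => -[i iF]; exists i.
  apply/subsetP => S SF; rewrite inE FV //=; exact: (bigcapP iF).
by apply/bigcapP => S SF; have := subsetP iF _ SF; rewrite inE => /andP[].
Qed.

Lemma exists_third (n : nat) (i j : 'I_n) :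
  2 < n -> exists2 k, k != i & k != j.
Proof.
move=> n2; have /card_gt0P[k] : 0 < #|~: [set i; j]|.
  by rewrite cardsCs setCK card_ord cards2; case: (i != j); lia.
by rewrite !inE negb_or => /andP[ki kj]; exists k.
Qed.

(** * Bounds on the sums over families *)

Local Open Scope ring_scope.

Lemma weight1D (K : realType) (n : nat) (S : {set 'I_n}) :
  1 + weight K S = 2 ^+ (2 ^ (n - #|S|)).
Proof. by rewrite addrC subrK. Qed.

Lemma prod_weight1D (K : realType) (n : nat) (M : {set {set 'I_n}}) :
  \prod_(S in M) (1 + weight K S) = 2 ^+ mass M.
Proof.
by rewrite /mass -prodrXr; apply: eq_bigr => S _; exact: weight1D.
Qed.

(** Expand the product over all [S] of [f S] (chosen) plus [g S] (omitted): a family outside the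
    interval gets a zero factor. A forced [S] contributes [w = (1 + w) * (1 - 1 / (1 + w))] instead
    of [1 + w]. *)
Lemma sum_between (K : realType) (n : nat) (A M : {set {set 'I_n}}) :
  A \subset M ->
  \sum_(F : {set {set 'I_n}} | (A \subset F) && (F \subset M)) weight_prod K F =
  2 ^+ mass M * \prod_(S in A) (1 - (2 ^+ (2 ^ (n - #|S|)))^-1).
Proof.
move=> AM; pose f S := if S \in M then weight K S else 0.
pose g S : K := if S \in A then 0 else 1.
have fg S : f S + g S = (if S \in M then 1 + weight K S else 1) *
    (if S \in A then 1 - (2 ^+ (2 ^ (n - #|S|)))^-1 else 1).
  rewrite /f /g; have [SA|_] := boolP (S \in A); last first.
    by rewrite mulr1; case: ifP; rewrite ?add0r // addrC.
  rewrite (subsetP AM) // addr0 weight1D mulrBr mulr1 mulfV //.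
  by rewrite expf_neq0 // pnatr_eq0.
transitivity (\prod_S (f S + g S)); last first.
  rewrite (eq_bigr _ (fun S _ => fg S)) big_split /=.
  by rewrite -!big_mkcond /= prod_weight1D.
rewrite bigA_distr big_mkcond /=; apply: eq_bigr => F _.
have [/andP[AF FM]|] := boolP ((A \subset F) && (F \subset M)).
  rewrite /weight_prod big_mkcond /=; apply: eq_bigr => S _.
  rewrite /f /g; case: ifP => [SF|/negbT SF]; first by rewrite (subsetP FM).
  by case: ifP => // /(subsetP AF); rewrite (negPf SF).
rewrite negb_and => /orP[]/subsetPn[S SF SM]; rewrite (bigD1 S) //=.
  by rewrite (negPf SM) /g SF mul0r.
by rewrite SF /f (negPf SM) mul0r.
Qed.

Lemma sum_sub (K : realType) (n : nat) (M : {set {set 'I_n}}) :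
  \sum_(F : {set {set 'I_n}} | F \subset M) weight_prod K F = 2 ^+ mass M.
Proof.
have := @sum_between K n set0 M (sub0set M); rewrite big_set0 mulr1 => <-.
by apply: eq_bigl => F; rewrite sub0set.
Qed.

(** This is the union bound, used for the upper estimates. *)
Lemma sum_le_cover (K : realType) (I J : finType) (R : pred I) (P : pred J)
    (Q : I -> pred J) (f : J -> K) :
  (forall j, 0 <= f j) -> (forall j, P j -> exists2 i, R i & Q i j) ->
  \sum_(j | P j) f j <= \sum_(i | R i) \sum_(j | Q i j) f j.
Proof.
move=> f0 cover; rewrite (exchange_big_dep predT) //= big_mkcond /=.
apply: ler_sum => j _; case: ifP => [/cover[i Ri Qij]|_].
  by rewrite (bigD1 i) /= ?Ri // lerDl sumr_ge0.
exact: sumr_ge0.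
Qed.

Lemma sum_ge_packing (K : realType) (I J : finType) (P : pred J)
    (Q : I -> pred J) (f : J -> K) :
  (forall j, 0 <= f j) -> (forall i j, Q i j -> P j) ->
  (forall i i' j, Q i j -> Q i' j -> i = i') ->
  \sum_i \sum_(j | Q i j) f j <= \sum_(j | P j) f j.
Proof.
move=> f0 QP Qinj; rewrite (exchange_big_dep P) /=; last by move=> i j _ /QP.
apply: ler_sum => j Pj.
case: (pickP (fun i => Q i j)) => [i Qij|noQ]; last by rewrite big_pred0.
rewrite (bigD1 i) //= big1 ?addr0 // => k /andP[Qkj].
by rewrite (Qinj _ _ _ Qkj Qij) eqxx.
Qed.

Lemma Wsum_split (K : realType) (n : nat) :
  Wsum K n = Rsum K n +
    \sum_(F : {set {set 'I_n}} | intersecting F && condensed F) weight_prod K F.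
Proof. by rewrite /Wsum (bigID (@noncondensed n)). Qed.

Lemma Wsum_le (K : realType) (n : nat) :
  Wsum K n <= n%:R * 2 ^+ (3 ^ n.-1) + Rsum K n.
Proof.
rewrite Wsum_split addrC lerD2r.
have cover (F : {set {set 'I_n}}) : intersecting F && condensed F ->
    exists2 i, predT i & F \subset @Star n i.
  by case/andP=> intF /(condensedP intF)[i Fi]; exists i.
apply: le_trans (sum_le_cover (@weight_prod_ge0 K n) cover) _.
under eq_bigr => i _ do rewrite sum_sub mass_Star.
by rewrite sumr_const card_ord mulr_natl.
Qed.

(** Only the families containing [[set i]] are kept in the star of [i]. This makes the stars
    contribute disjointly, since [[set i]] and [[set j]] do not meet for distinct [i] and [j]. *)
Lemma Wsum_ge (K : realType) (n : nat) :
  n%:R * (2 ^+ (3 ^ n.-1) * (1 - (2 ^+ (2 ^ n.-1))^-1)) <= Wsum K n.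
Proof.
pose Q i (F : {set {set 'I_n}}) :=
  ([set [set i]] \subset F) && (F \subset @Star n i).
have Qint i F : Q i F -> intersecting F.
  by move=> /andP[_]; exact: Star_intersecting.
have Qinj i j F : Q i F -> Q j F -> i = j.
  move=> QiF /andP[+ _]; have /andP[+ _] := QiF; rewrite !sub1set => iF jF.
  have := intersectingP _ (Qint _ _ QiF) _ _ iF jF.
  by case/set0Pn=> k; rewrite !inE => /andP[/eqP-> /eqP].
apply: le_trans (sum_ge_packing (@weight_prod_ge0 K n) Qint Qinj).
rewrite (eq_bigr (fun=> 2 ^+ (3 ^ n.-1) * (1 - (2 ^+ (2 ^ n.-1))^-1))).
  by rewrite sumr_const card_ord mulr_natl.
move=> i _; rewrite sum_between ?mass_Star ?big_set1 ?cards1 ?subn1 //.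
by rewrite sub1set !inE eqxx andbT; apply/set0Pn; exists i; rewrite inE.
Qed.

(** A noncondensed family extends to a maximal one that lies in no star. Inside the Hilton-Milner
    family of [i] it must contain [[set~ i]], as otherwise it would lie in [Star i]; the other
    maximal families are summed by [card_maximal]. *)
Lemma Rsum_le (K : realType) (n : nat) : (4 < n)%N ->
  Rsum K n <= n%:R * (3 * 2 ^+ (3 ^ n.-1) / 2 ^+ (2 ^ n.-1)) +
    168 ^+ (2 ^ (n - 5)) * (2 ^+ (3 ^ n.-1 + 8) / 2 ^+ (3 * 2 ^ (n - 2))).
Proof.
move=> n4; pose small (M : {set {set 'I_n}}) :=
  maxset (@intersecting n) M && (mass M + 3 * 2 ^ (n - 2) <= 3 ^ n.-1 + 8)%N.
pose Qh i (F : {set {set 'I_n}}) :=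
  ([set [set~ i]] \subset F) && (F \subset @hilton_milner n i).
pose R (s : 'I_n + {set {set 'I_n}}) := if s is inr M then small M else true.
pose Q (s : 'I_n + {set {set 'I_n}}) F :=
  match s with inl i => Qh i F | inr M => F \subset M end.
have cover (F : {set {set 'I_n}}) :
    intersecting F && noncondensed F -> exists2 s, R s & Q s F.
  case/andP=> intF ncF.
  have noStar i : ~~ (F \subset Star i).
    by apply/negP => Fi; have /negP[] : condensed F by apply/condensedP=> //; exists i.
  have [M maxM FM] := @maxset_exists _ (@intersecting n) F intF.
  have [[i Mi]|[i Mi]|Msmall] := maximal_cases n4 maxM.
  - by have := noStar i; rewrite (subset_trans FM Mi).
  - exists (inl i) => //=; rewrite /Qh (subset_trans FM Mi) andbT sub1set.
    apply: contraR (noStar i) => iF; apply/subsetP => S SF.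
    have := subsetP (subset_trans FM Mi) _ SF; rewrite !inE.
    by case: eqP => [ES|_ /andP[]//]; rewrite -ES SF in iF.
  - by exists (inr M); rewrite //= /small maxM.
apply: le_trans (sum_le_cover (@weight_prod_ge0 K n) cover) _.
rewrite big_sumType /= lerD //.
  rewrite (eq_bigr (fun=> 3 * 2 ^+ (3 ^ n.-1) / 2 ^+ (2 ^ n.-1))).
    by rewrite sumr_const card_ord -[X in X <= _]mulr_natl.
  move=> i _; rewrite sum_between ?sub1set ?setU11 // big_set1 cardsC1 card_ord.
  (* The forced member [[set~ i]] brings the factor [1 - 1/4], which turns the [2 ^ 2] of the
     Hilton-Milner mass into the constant 3. *)
  have -> : (n - n.-1 = 1)%N by lia.
  have h0 : 2 ^+ (2 ^ n.-1) != 0 :> K by rewrite expf_neq0 // pnatr_eq0.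
  apply: (mulIf h0); rewrite mulrAC -exprD mass_hilton_milner mulfVK // exprD.
  by rewrite -[(2 ^ 1)%N]/2%N; field.
apply: le_trans (_ : \sum_(M | small M)
  2 ^+ (3 ^ n.-1 + 8) / 2 ^+ (3 * 2 ^ (n - 2)) <= _).
  apply: ler_sum => M /andP[_ Msmall]; rewrite sum_sub.
  rewrite ler_pdivlMr ?exprn_gt0 // -exprD ler_weXn2l //.
  by rewrite ler1n.
rewrite sumr_const -[X in X <= _]mulr_natl ler_wpM2r ?divr_ge0 ?exprn_ge0 //.
rewrite -natrX ler_nat (leq_trans _ (card_maximal n4)) // subset_leq_card //.
by apply/subsetP => M; rewrite inE => /andP[].
Qed.

Lemma Rsum_ge (K : realType) (n : nat) : (4 < n)%N ->
  n%:R * (3 * 2 ^+ (3 ^ n.-1) / 2 ^+ (2 ^ n.-1) *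
    (1 - 2 ^+ n / 2 ^+ (2 ^ (n - 2)))) <= Rsum K n.
Proof.
move=> n4; pose pairs (i : 'I_n) : {set {set 'I_n}} :=
    [set S : {set 'I_n} | (i \in S) && (#|S| == 2)].
(* Requiring all pairs through i makes the families F noncondensed and
   determines i, at the cost of a factor 1 - o(1). *)
pose A i := [set~ i] |: pairs i.
pose Q i (F : {set {set 'I_n}}) :=
  (A i \subset F) && (F \subset @hilton_milner n i).
have AHM i : A i \subset hilton_milner i.
  apply/subsetP => S; rewrite !inE => /orP[->//|/andP[iS S2]].
  apply/orP; right; rewrite iS andbT; apply/andP; split.
    by apply: contraL S2 => /eqP->; rewrite cards1.
  by rewrite -card_gt0 (eqP S2).
have pairF i k F : Q i F -> k != i -> [set i; k] \in F.
  move=> /andP[/subsetP AF _] ki; apply: AF.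
  by rewrite !inE eqxx cards2 (eq_sym i) ki orbT.
have Qint i F : Q i F -> intersecting F && noncondensed F.
  move=> QF; have /andP[AF FH] := QF.
  rewrite (hilton_milner_intersecting _ FH) /=; last by lia.
  (* The point [i] is excluded from the kernel by [[set~ i]], and any other [k] by a pair
     [[set i; l]] with [l] different from [k]. *)
  apply/eqP/setP => k; rewrite inE; apply/negP => /bigcapP kF.
  have ki : k != i.
    have : k \in [set~ i] by apply/kF/(subsetP AF); rewrite setU11.
    by rewrite !inE.
  have [|l li lk] := exists_third i k; first by lia.
  have := kF _ (pairF _ _ _ QF li); rewrite !inE (negPf ki) /=.
  by rewrite eq_sym (negPf lk).
have Qinj i j F : Q i F -> Q j F -> i = j.
  (* A pair [[set i; l]] with [l] different from [j] does not contain [j] and is too small to be the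
     complement of [j]. *)
  move=> QiF /andP[_ FH]; apply/eqP/negPn/negP => ij.
  have [|l li lj] := exists_third i j; first by lia.
  have := subsetP FH _ (pairF _ _ _ QiF li); rewrite !inE => /orP[/eqP E|].
    have := cardsC1 j; rewrite -E cards2 card_ord; case: (i != l); lia.
  by case/and3P => _ _; rewrite !(eq_sym j) (negPf ij) (negPf lj).
apply: le_trans (sum_ge_packing (@weight_prod_ge0 K n) Qint Qinj).
rewrite [X in X <= _]mulr_natl -[X in _ *+ X]card_ord -sumr_const; apply: ler_sum => i _.
rewrite sum_between // big_setU1 /=; last by rewrite !inE eqxx.
rewrite cardsC1 card_ord (_ : n - n.-1 = 1)%N; last by lia.
set c : K := (2 ^+ (2 ^ (n - 2)))^-1.
have h0 : 2 ^+ (2 ^ n.-1) != 0 :> K by rewrite expf_neq0 // pnatr_eq0.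
have -> : 2 ^+ mass (hilton_milner i) = 4 * 2 ^+ (3 ^ n.-1) / 2 ^+ (2 ^ n.-1) :> K.
  apply: (mulIf h0); rewrite -exprD mass_hilton_milner mulfVK // exprD.
  by rewrite mulrC; congr (_ * _); ring.
rewrite (eq_bigr (fun=> 1 - c)) => [|S]; last first.
  by rewrite inE => /andP[_ /eqP->].
rewrite prodr_const.
have c01 : 0 <= c <= 1.
  by rewrite invr_ge0 exprn_ge0 //= invf_le1 ?exprn_gt0 // exprn_ege1 // ler1n.
(* Bernoulli's inequality; the number of pairs through [i] is then bounded crudely by [2 ^ n]. *)
have bern k : 1 - k%:R * c <= (1 - c) ^+ k.
  elim: k => [|k IHk]; first by rewrite mul0r subr0.
  rewrite exprS -natr1; have : 0 <= k%:R :> K by [].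
  by move: (k%:R) IHk => t IHk t0; nra.
have : 1 - 2 ^+ n * c <= (1 - c) ^+ #|pairs i|.
  apply: le_trans (bern _); rewrite lerD2l lerN2 ler_wpM2r //.
    by case/andP: c01.
  rewrite -natrX ler_nat (leq_trans (max_card _)) //.
  by rewrite -[#|{set _}|]cardsT -powersetT card_powerset cardsT card_ord.
rewrite -[(2 ^ 1)%N]/2%N => bound.
have -> : 4 * 2 ^+ (3 ^ n.-1) / 2 ^+ (2 ^ n.-1) *
    ((1 - (2 ^+ 2)^-1) * (1 - c) ^+ #|pairs i|) =
    3 * 2 ^+ (3 ^ n.-1) / 2 ^+ (2 ^ n.-1) * (1 - c) ^+ #|pairs i| :> K.
  move: (2 ^+ (3 ^ _)) (_ ^-1) (_ ^+ #|_|) => y h z.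
  by field.
by rewrite ler_wpM2l // divr_ge0 ?mulr_ge0 ?exprn_ge0.
Qed.

(* Imported only here because classical_sets shadows the finset names. *)
From mathcomp Require Import all_classical all_reals all_analysis.
Import numFieldNormedType.Exports.

(** * Explicit estimate of the ratio *)

Lemma leq_mul2_exp2 (n : nat) : (9 < n)%N -> (n <= 2 ^ (n - 6))%N.
Proof.
move=> n9; rewrite -(subnK n9) (_ : _ + _ - 6 = (n - 10) + 4)%N; last by lia.
by elim: (n - 10)%N => // k IHk; rewrite !addSn expnS; lia.
Qed.

(** Since [168 ^ 2 = 28224] is below [2 ^ 15 = 32768]. *)
Lemma leq_168_exp (k : nat) : (168 ^ (2 * k) <= 2 ^ (15 * k))%N.
Proof.
by case: k => // k; rewrite (expnM 168) (expnM 2) leq_exp2r.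
Qed.

(** With [y = 2 ^ (3 ^ n.-1)], [H = 2 ^ (2 ^ n.-1)] and [a = n * y / H], the leading terms are
    [3 * a] for [Rsum] and [a * H] for [Wsum]; the corrections are controlled by
    [t = 256 / 2 ^ n]. *)
Lemma noncondensed_ratio (K : realType) (n : nat) :
  (9 < n)%N ->
  `|Rsum K n / Wsum K n * 2 ^+ (2 ^ n.-1) - 3| <= 15 * (256 / 2 ^+ n).
Proof.
move=> n9; have n4 : (4 < n)%N by lia.
have n1 : 1 <= n%:R :> K by rewrite ler1n; lia.
have pow0 k : 0 < 2 ^+ k :> K by rewrite exprn_gt0.
have pow_le j k : (j <= k)%N -> 2 ^+ j <= 2 ^+ k :> K.
  by move=> jk; rewrite ler_weXn2l // ler1n.
have n6 := leq_mul2_exp2 n9.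
have e2 : (2 ^ (n - 2) = 16 * 2 ^ (n - 6))%N.
  by rewrite -[16%N]/(2 ^ 4)%N -expnD; congr (2 ^ _)%N; lia.
have e1 : (2 ^ n.-1 = 32 * 2 ^ (n - 6))%N.
  by rewrite -[32%N]/(2 ^ 5)%N -expnD; congr (2 ^ _)%N; lia.
have e5 : (2 ^ (n - 5) = 2 * 2 ^ (n - 6))%N.
  by rewrite -expnS; congr (2 ^ _)%N; lia.
have Rle := Rsum_le K n4; have Rge := Rsum_ge K n4.
have Wle := Wsum_le K n; have Wge := Wsum_ge K n.
have W0 := Wsum_gt0 K n.
set t : K := 256 / 2 ^+ n.
have E256 : 256 = 2 ^+ 8 :> K by rewrite -natrX.
have t0 : 0 < t by rewrite divr_gt0 ?ltr0n.
have t4 : t <= 4^-1.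
  rewrite /t ler_pdivrMr // mulrC ler_pdivlMr // E256 (_ : 4 = 2 ^+ 2); last by ring.
  by rewrite -exprD pow_le.
move: Rle Rge Wle Wge W0.
set y : K := 2 ^+ (3 ^ n.-1); set H : K := 2 ^+ (2 ^ n.-1).
have H0 : 0 < H := pow0 _; have y0 : 0 < y := pow0 _.
have tH : 1 <= t * H.
  rewrite /t mulrAC ler_pdivlMr // mul1r E256 -exprD pow_le //.
  by rewrite e1; lia.
have delta : 2 ^+ n / 2 ^+ (2 ^ (n - 2)) <= t.
  rewrite /t ler_pdivrMr // mulrAC ler_pdivlMr // E256 -!exprD pow_le //.
  by rewrite e2; lia.
(* In terms of [k = 2 ^ (n - 6)], after division by [y / H] the exponent of 2 is at most
   [32 k + 8 + 15 k - 48 k = 8 - k], hence at most [8 - n]. The 8 is that of the mass bound and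
   explains the 256 in [t]. *)
have err : 168 ^+ (2 ^ (n - 5)) * (2 ^+ (3 ^ n.-1 + 8) / 2 ^+ (3 * 2 ^ (n - 2)))
    <= y / H * t.
  have factor (y' h p q l : K) : h != 0 -> l != 0 ->
      p * (y' * q / l) = y' / h * (h * (q * p) / l).
    by move=> h0 l0; field; rewrite h0 l0.
  rewrite exprD -/y (factor _ H); try by rewrite gt_eqF.
  rewrite ler_pM2l ?divr_gt0 // ler_pdivrMr //.
  apply: le_trans (_ : H * (2 ^+ 8 * 2 ^+ (15 * 2 ^ (n - 6))) <= _).
    by rewrite !ler_pM2l // e5 -!natrX ler_nat; exact: leq_168_exp.
  rewrite /t [leRHS]mulrAC ler_pdivlMr // /H E256 -!exprD pow_le //.
  by rewrite e1 e2; lia.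
move: err delta; set r := 2 ^+ n / _; set z := 168 ^+ _ * _.
set R := Rsum K n; set W := Wsum K n => err delta Rle Rge Wle Wge W0.
pose a := n%:R * (y / H).
have a0 : 0 < a by rewrite mulr_gt0 ?divr_gt0 // (lt_le_trans ltr01).
have aH : n%:R * y = a * H by rewrite /a -mulrA divfK // gt_eqF.
have n3 : n%:R * (3 * y / H) = 3 * a by rewrite /a -mulrA mulrCA.
have R1 : R <= (3 + t) * a.
  apply: le_trans Rle _; rewrite n3 [leRHS]mulrDl lerD2l.
  apply: le_trans err _; rewrite mulrC ler_pM2l // ler_peMl //.
  by rewrite divr_ge0 // ltW.
clearbody a.
have R2 : 3 * (1 - t) * a <= R.
  apply: le_trans Rge; rewrite mulrA n3 [leLHS]mulrAC.
  by rewrite ler_pM2l ?mulr_gt0 ?ltr0n // lerB.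
have W1 : a * H * (1 - t) <= W.
  apply: le_trans Wge; rewrite mulrA aH ler_pM2l ?mulr_gt0 ?ltr0n // lerB //.
  by rewrite -div1r ler_pdivrMr.
have W2 : W <= a * H + (3 + t) * a by rewrite -aH (le_trans Wle) // lerD2l.
(* The constant 15 suits both sides. The lower bound, when [3 - 15 * t] is positive, needs
   [12 * (t * H) >= (3 - 15 * t) * (3 + t)], which follows from [t * H >= 1]; the upper bound needs
   [11 - 15 * t >= 0], which follows from [t <= 1/4]. *)
rewrite ler_norml [R / W * H]mulrAC; apply/andP; split.
  rewrite lerBrDl ler_pdivlMr //.
  have [neg|pos] := leP (3 - 15 * t) 0.
    apply: le_trans (_ : 0 <= _); first by rewrite mulr_le0_ge0 // ltW.
    rewrite mulr_ge0 ?(ltW H0) // (le_trans _ R2) //.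
    by rewrite mulr_ge0 ?(ltW a0) // mulr_ge0 // subr_ge0; lra.
  apply: le_trans (_ : (3 - 15 * t) * (a * H + (3 + t) * a) <= _).
    by rewrite ler_pM2l.
  apply: le_trans (_ : 3 * (1 - t) * a * H <= _); last by rewrite ler_pM2r.
  rewrite -subr_ge0 (_ : _ - _ = a * (12 * (t * H) - (3 - 15 * t) * (3 + t))).
    by rewrite mulr_ge0 ?(ltW a0) //; nra.
  by ring.
rewrite lerBlDl ler_pdivrMr //.
apply: le_trans (_ : (3 + t) * a * H <= _); first by rewrite ler_pM2r.
apply: le_trans (_ : (3 + 15 * t) * (a * H * (1 - t)) <= _); last first.
  by rewrite ler_pM2l //; lra.
rewrite -subr_ge0 (_ : _ - _ = a * H * (t * (11 - 15 * t))); last by ring.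
by rewrite !mulr_ge0 ?(ltW a0) ?(ltW H0) ?(ltW t0) //; lra.
Qed.

(** * Probabilities and limits *)

Lemma Prob_noncondensed (K : realType) (n : nat) :
  Prob K (@noncondensed n) = Rsum K n / Wsum K n.
Proof.
rewrite /Prob /gibbs -big_mkcondr /= /Rsum mulr_suml.
by apply: eq_bigl => F; rewrite andbC.
Qed.

Lemma Prob_condensed (K : realType) (n : nat) :
  Prob K (@condensed n) = 1 - Prob K (@noncondensed n).
Proof.
by rewrite -(gibbs_sum1 K n) (bigID (@noncondensed n)) /= addrC addrK.
Qed.

Local Open Scope classical_set_scope.

Lemma cvg_expr_half (K : realType) : 2 ^- n @[n --> \oo] --> (0 : K).
Proof.
under eq_fun do rewrite -exprVn.
by apply: cvg_expr; rewrite ger0_norm ?invr_ge0 // invf_lt1 // ltr1n.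
Qed.

Definition rel_error (K : realType) (n : nat) : K :=
  Rsum K n / Wsum K n * 2 ^+ (2 ^ n.-1) - 3.

Lemma cvg_rel_error (K : realType) : rel_error K n @[n --> \oo] --> (0 : K).
Proof.
have bound0 : 15 * (256 / 2 ^+ n) @[n --> \oo] --> (0 : K).
  rewrite -(mulr0 (15 * 256)); under eq_fun do rewrite mulrA.
  by apply: cvgM; [exact: cvg_cst | exact: cvg_expr_half].
apply: (@squeeze_cvgr _ _ _ _ (fun n => - (15 * (256 / 2 ^+ n)))
  (fun n => 15 * (256 / 2 ^+ n))) => //.
  near=> n; rewrite -ler_norml; apply: noncondensed_ratio.
  by near: n; exact: nbhs_infty_gt.
by rewrite -oppr0; apply: cvgN.
Unshelve. all: by end_near. Qed.

Lemma powR2_opp_exp (K : realType) (n : nat) :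
  2 `^ (- 2 ^+ n) = (2 ^+ (2 ^ n))^-1 :> K.
Proof. by rewrite powRN -natrX powR_mulrn. Qed.

Unset Implicit Arguments.

Theorem corollary1p5 (K : realType) :
  [/\ forall n : nat, Prob K (@noncondensed n) = Rsum K n / Wsum K n,
      exists e : nat -> K,
        [/\ e n @[n --> \oo] --> (0 : K),
            \forall n \near \oo,
              Prob K (@noncondensed n)
                = 2 `^ (- (2 ^+ n.-1 * (1 + e n)))
          & \forall n \near \oo,
              Prob K (@condensed n)
                = 1 - 2 `^ (- (2 ^+ n.-1 * (1 + e n)))],
      forall (n : nat) (F : {set {set 'I_n}}), intersecting F ->
        (condensed F <-> exists i : 'I_n, F \subset Star i),
      Prob K (@condensed n) @[n --> \oo] --> (1 : K)
    & exists d : nat -> K,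
        d n @[n --> \oo] --> (0 : K) /\
        \forall n \near \oo,
          Prob K (@noncondensed n) = (3 + d n) * 2 `^ (- 2 ^+ n.-1)].
Proof.
have d0 := @cvg_rel_error K.
have PE n : Prob K (@noncondensed n) = (3 + rel_error K n) * 2 `^ (- 2 ^+ n.-1).
  by rewrite Prob_noncondensed /rel_error addrC subrK powR2_opp_exp mulfK.
have half0 : 2 ^- n.-1 @[n --> \oo] --> (0 : K).
  by rewrite -cvg_shiftS /=; exact: cvg_expr_half.
have d3 : 3 + rel_error K n @[n --> \oo] --> (3 : K).
  by rewrite -[X in _ --> X]addr0; apply: cvgD => //; exact: cvg_cst.
have ln2 : 0 < ln 2 :> K by rewrite ln_gt0 // ltr1n.
(* Obtained by solving [(3 + rel_error K n) * 2 ^ (- N) = 2 ^ (- N * (1 + e n))] with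
   [N = 2 ^ n.-1]. The logarithm requires [3 + rel_error K n] to be positive, which holds
   eventually. *)
pose e n : K := - (ln (3 + rel_error K n) / ln 2 * 2 ^- n.-1).
have Pe : \forall n \near \oo,
    Prob K (@noncondensed n) = 2 `^ (- (2 ^+ n.-1 * (1 + e n))).
  near=> n; have pos : 0 < 3 + rel_error K n.
    near: n; apply: (cvgr_gt _ d3); exact: ltr0n.
  have h0 : 2 ^+ n.-1 != 0 :> K by rewrite expf_neq0 // pnatr_eq0.
  rewrite PE -{1}(lnK (pos : _ \is Num.pos)) /powR pnatr_eq0 /= -expRD.
  by congr expR; rewrite /e; field; rewrite h0 gt_eqF.
have Pto0 : Prob K (@noncondensed n) @[n --> \oo] --> (0 : K).
  under eq_fun => n do rewrite PE powR2_opp_exp.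
  rewrite -(mulr0 3); apply: cvgM => //.
  (* The double exponential is compared with a geometric sequence through [n.-1 < 2 ^ n.-1]. *)
  apply: (@squeeze_cvgr _ _ _ _ (fun=> 0) (fun n => 2 ^- n.-1)) => //.
    near=> n; rewrite invr_ge0 exprn_ge0 //= lef_pV2 ?posrE ?exprn_gt0 //.
    by rewrite ler_weXn2l ?ler1n // ltnW // ltn_expl.
  exact: cvg_cst.
split.
- exact: Prob_noncondensed.
- exists e; split=> //.
    rewrite /e -oppr0 -(mulr0 (ln 3 / ln 2)).
    apply: cvgN; apply: cvgM => //; apply: cvgM; last exact: cvg_cst.
    by apply: (@continuous_cvg _ _ _ _ _ _ (@ln K)) => //; exact/continuous_ln/ltr0n.
  near=> n; rewrite Prob_condensed; congr (1 - _); near: n; exact: Pe.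
- by move=> n F intF; split=> /(condensedP intF).
- have -> : (fun n => Prob K (@condensed n)) =
             (fun n => 1 - Prob K (@noncondensed n)).
    by apply/funext => n; exact: Prob_condensed.
  by rewrite -[X in _ --> X](subr0 1); apply: cvgB => //; exact: cvg_cst.
- by exists (rel_error K); split=> //; apply: nearW.
Unshelve. all: by end_near. Qed.
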